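(* Let $A$ be a finite dimensional algebra over a field $F$ such that $J(A)^2=0$ and $J(A)$ is simple as an $A/J(A)$-bimodule. Suppose furthermore that $A/J(A)$ is a separable $F$-algebra. For $k\geq 2$, any sequence of $k$ elements which generate the $F$-algebra $A/J(A)$ can be lifted to a sequence of $k$ elements in $A$ which generate $A$ as an $F$-algebra. If $A$ is commutative, the same holds for $k=1$. Suppose furthermore that $F$ is finite and $J(A)\neq 0$, and let $C$ be the intersection of $J(A)$ and the center of $A$. Then \[ g_k(A, A/J(A))= |J(A)|^k- |J(A)/C|. \]
   Context: Algebras are associative with identity, subalgebras contain the identity. $J(A)$ denotes the Jacobson radical of $A$. Since $J(A)^2=0$, $J(A)$ is naturally an $A/J(A)$-bimodule. Here ''simple'' means having no sub-bimodules other than $0$ and itself; the case $J(A)=0$ is allowed in the first part. Elements generate an $F$-algebra if the smallest unital $F$-subalgebra containing them is the whole algebra. For a finite algebra $A$, a quotient $B$ of $A$ and a positive integer $k$, $g_k(A,B)$ is the number such that every $k$-tuple of elements generating the $F$-algebra $B$ has exactly $g_k(A,B)$ lifts (under the quotient map) to $k$-tuples generating the $F$-algebra $A$; this number does not depend on the generating $k$-tuple of $B$. If $B$ cannot be generated by $k$ elements, $g_k(A,B)$ is not well defined and is assigned any convenient value, so the formula carries content only when $B$ can be generated by $k$ elements. *)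

(* Defs.v *)
From HB Require Import structures.
From mathcomp Require Import all_boot all_order all_algebra all_field.
From mathcomp Require Import finmap.
From mathcomp Require Import boolp classical_sets functions cardinality.

Set Implicit Arguments.
Unset Strict Implicit.
Unset Printing Implicit Defensive.

Import GRing.Theory.
Local Open Scope ring_scope.
Local Open Scope quotient_scope.

(* A left ideal of a unital algebra over a field is automatically a subspace, *)
(* so that left ideals can be taken in {vspace A}.                            *)
Definition left_ideal (F : fieldType) (A : falgType F) (U : {vspace A}) : Prop :=
  forall a u : A, u \in U -> a * u \in U.

Definition maximal_left_ideal (F : fieldType) (A : falgType F)
    (U : {vspace A}) : Prop :=
  [/\ left_ideal U, U != fullv
    & forall V : {vspace A}, left_ideal V -> (U <= V)%VS -> V = U \/ V = fullv].

Section JacobsonExists.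
Variables (F : fieldType) (A : falgType F).
Implicit Types U V J : {vspace A}.

Lemma jacobson_exists : exists J : {vspace A}, forall x,
  x \in J <-> forall U, maximal_left_ideal U -> x \in U.
Proof.
pose P n := `[< exists J : {vspace A}, \dim J = n /\
  exists s : seq {vspace A}, (forall U, U \in s -> maximal_left_ideal U) /\
    J = (\bigcap_(U <- s) U)%VS >].
have exP : exists n, P n.
  exists (\dim {:A}); apply/asboolP; exists fullv; split=> //.
  by exists [::]; split=> //; rewrite big_nil.
case: (ex_minnP exP) => n /asboolP[J [dJ [s [sP JE]]]] minJ.
exists J => x; split=> [xJ U Umax|xU].
  have : P (\dim (U :&: J)%VS).
    apply/asboolP; exists (U :&: J)%VS; split=> //; exists (U :: s); split.
      by move=> V; rewrite inE => /predU1P[->//|]; apply: sP.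
    by rewrite big_cons JE.
  move=> /minJ; rewrite -dJ => leJ.
  have /eqP UJ : (U :&: J)%VS == J by rewrite eqEdim capvSr leJ.
  by move: xJ; rewrite -UJ memv_cap => /andP[].
rewrite JE {JE J dJ}.
elim: s sP {minJ} => [|U s IHs] sP; first by rewrite big_nil memvf.
rewrite big_cons memv_cap xU/=; last by apply: sP; rewrite mem_head.
by apply: IHs => V Vs; apply: sP; rewrite inE Vs orbT.
Qed.

End JacobsonExists.

Definition jacobson (F : fieldType) (A : falgType F) : {vspace A} :=
  projT1 (cid (jacobson_exists A)).

Section Jacobson.
Variables (F : fieldType) (A : falgType F).
Implicit Types U V : {vspace A}.

Lemma jacobsonP (x : A) :
  x \in jacobson A <-> forall U, maximal_left_ideal U -> x \in U.
Proof. exact: (projT2 (cid (jacobson_exists A))). Qed.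

Lemma left_ideal_full U : left_ideal U -> 1 \in U -> U = fullv.
Proof.
move=> Ui U1; apply/eqP; rewrite eqEsubv subvf; apply/subvP => x _.
by rewrite -[x]mulr1; apply: Ui.
Qed.

Lemma jacobson1 : (1 : A) \notin jacobson A.
Proof.
pose P n := `[< exists U : {vspace A},
  [/\ \dim U = n, left_ideal U & U != fullv] >].
have exP : exists n, P n.
  exists (\dim (0%VS : {vspace A})); apply/asboolP; exists 0%VS; split=> //.
    by move=> a u; rewrite !memv0 => /eqP->; rewrite mulr0.
  apply/eqP => A0; have := memvf (1 : A).
  by rewrite -A0 memv0 (negPf (oner_neq0 _)).
have ubP n : P n -> (n <= \dim {:A})%N.
  by move=> /asboolP[U [<- _ _]]; exact/dimvS/subvf.
case: (ex_maxnP exP ubP) => n /asboolP[U [dU Ui Un]] maxU.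
apply/negP => /jacobsonP/(_ U) J1; suff /J1 U1 : maximal_left_ideal U.
  by rewrite (left_ideal_full Ui U1) eqxx in Un.
split=> // V Vi UV; have [->|Vn] := eqVneq V fullv; [by right|left].
apply/esym/eqP; rewrite eqEdim UV dU; apply: maxU.
by apply/asboolP; exists V.
Qed.

Lemma jacobsonMl (a x : A) : x \in jacobson A -> a * x \in jacobson A.
Proof.
move=> /jacobsonP xJ; apply/jacobsonP => U Um.
by case: (Um) => Ui _ _; apply/Ui/xJ.
Qed.

Lemma jacobsonMr (a x : A) : x \in jacobson A -> x * a \in jacobson A.
Proof.
move=> /jacobsonP xJ; apply/jacobsonP => U [Ui Un Um].
have [aU|aU] := boolP (a \in U); first exact: Ui.
pose W := (amulr a @^-1: U)%VS.
have WE y : (y \in W) = (y * a \in U) by rewrite -memv_preim lfunE.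
suff /xJ : maximal_left_ideal W by rewrite WE.
have Wi : left_ideal W by move=> b y; rewrite !WE -mulrA; apply: Ui.
split=> //; first by apply/eqP => Wf; have := memvf (1 : A); rewrite -Wf WE mul1r (negPf aU).
move=> V Vi WV; have [VW|] := boolP (V <= W)%VS.
  by left; apply/eqP; rewrite eqEsubv VW.
case/subvPn => v vV; rewrite WE => vaU; right.
apply: left_ideal_full => //.
pose T := (U + amulr a @: V)%VS.
have Ti : left_ideal T.
  move=> b _ /memv_addP[u uU [_ /memv_imgP[w wV ->] ->]].
  rewrite mulrDr lfunE /= mulrA memv_add ?Ui//.
  by apply/memv_imgP; exists (b * w); rewrite ?lfunE ?Vi.
have [TU|Tf] := Um _ Ti (addvSl _ _).
  have : v * a \in T.
    rewrite -[v * a]add0r memv_add ?mem0v//.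
    by apply/memv_imgP; exists v; rewrite ?lfunE.
  by rewrite TU (negPf vaU).
have : a \in T by rewrite Tf memvf.
case/memv_addP => u uU [_ /memv_imgP[w wV ->] aE].
rewrite -(subrK w 1) memvD//; apply: (subvP WV).
by rewrite WE mulrBl mul1r {1}aE lfunE /= addrK.
Qed.

End Jacobson.

Definition radquot (F : fieldType) (A : falgType F) : Type :=
  {ideal_quot (pred_of_vspace (jacobson A))}.

HB.instance Definition _ F A := Choice.on (@radquot F A).
HB.instance Definition _ F A := GRing.Zmodule.on (@radquot F A).
HB.instance Definition _ F A := EqQuotient.on (@radquot F A).

Section Radquot.
Variables (F : fieldType) (A : falgType F).
Local Notation J := (jacobson A).
Local Notation B := (radquot A).
Local Notation pi := (\pi_B : A -> B).

Lemma radquot_eq (x y : A) : (pi x == pi y) = (x - y \in J).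
Proof. exact/esym/Quotient.idealrBE. Qed.

Lemma radquot_repr (x : A) : x - repr (pi x) \in J.
Proof. by rewrite -radquot_eq reprK. Qed.

Lemma radquot_is_zmod_morphism : zmod_morphism pi.
Proof. by move=> x y; rewrite !piE. Qed.

Definition radquot_one : B := pi 1.
Definition radquot_mul := lift_op2 B *%R.
Definition radquot_scale (c : F) := lift_op1 B ( *:%R c).

Lemma radquot_mulE (x y : A) : radquot_mul (pi x) (pi y) = pi (x * y).
Proof.
unlock radquot_mul; apply/eqP; rewrite eq_sym radquot_eq.
rewrite -(subrK (x * repr (pi y)) (x * y)) -mulrBr -addrA -mulrBl.
by apply: memvD; [apply: jacobsonMl | apply: jacobsonMr]; exact: radquot_repr.
Qed.

Lemma radquot_scaleE c (x : A) : radquot_scale c (pi x) = pi (c *: x).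
Proof.
unlock radquot_scale; apply/eqP.
by rewrite eq_sym radquot_eq -scalerBr memvZ// radquot_repr.
Qed.

Fact radquot_mulA : associative (@radquot_mul).
Proof.
by move=> x y z; rewrite -[x]reprK -[y]reprK -[z]reprK !radquot_mulE mulrA.
Qed.

Fact radquot_mul1 : left_id radquot_one radquot_mul.
Proof. by move=> x; rewrite -[x]reprK radquot_mulE mul1r. Qed.

Fact radquot_mulr1 : right_id radquot_one radquot_mul.
Proof. by move=> x; rewrite -[x]reprK radquot_mulE mulr1. Qed.

Let piD x y : pi x + pi y = pi (x + y). Proof. by rewrite !piE. Qed.

Fact radquot_mulDl : left_distributive radquot_mul +%R.
Proof.
by move=> x y z; rewrite -[x]reprK -[y]reprK -[z]reprK !(piD, radquot_mulE) mulrDl.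
Qed.

Fact radquot_mulDr : right_distributive radquot_mul +%R.
Proof.
by move=> x y z; rewrite -[x]reprK -[y]reprK -[z]reprK !(piD, radquot_mulE) mulrDr.
Qed.

Fact radquot_one_neq0 : radquot_one != 0.
Proof.
have -> : 0 = pi 0 by rewrite !piE.
by rewrite radquot_eq subr0 jacobson1.
Qed.

HB.instance Definition _ := GRing.Zmodule_isNzRing.Build B
  radquot_mulA radquot_mul1 radquot_mulr1 radquot_mulDl radquot_mulDr
  radquot_one_neq0.

Fact radquot_scaleA a b v :
  radquot_scale a (radquot_scale b v) = radquot_scale (a * b) v.
Proof. by rewrite -[v]reprK !radquot_scaleE scalerA. Qed.

Fact radquot_scale1 : left_id 1 radquot_scale.
Proof. by move=> x; rewrite -[x]reprK radquot_scaleE scale1r. Qed.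

Fact radquot_scaleDr : right_distributive radquot_scale +%R.
Proof.
by move=> a x y; rewrite -[x]reprK -[y]reprK !(piD, radquot_scaleE) scalerDr.
Qed.

Fact radquot_scaleDl v : {morph radquot_scale^~ v : a b / a + b}.
Proof.
by move=> a b; rewrite -[v]reprK !(piD, radquot_scaleE) scalerDl.
Qed.

HB.instance Definition _ := GRing.Zmodule_isLmodule.Build F B
  radquot_scaleA radquot_scale1 radquot_scaleDr radquot_scaleDl.

Fact radquot_scaleAl (a : F) (u v : B) : a *: (u * v) = (a *: u) * v.
Proof.
rewrite -[u]reprK -[v]reprK.
change (radquot_scale a (radquot_mul (pi (repr u)) (pi (repr v))) =
  radquot_mul (radquot_scale a (pi (repr u))) (pi (repr v))).
by rewrite !(radquot_mulE, radquot_scaleE) scalerAl.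
Qed.

Fact radquot_scaleAr (a : F) (u v : B) : a *: (u * v) = u * (a *: v).
Proof.
rewrite -[u]reprK -[v]reprK.
change (radquot_scale a (radquot_mul (pi (repr u)) (pi (repr v))) =
  radquot_mul (pi (repr u)) (radquot_scale a (pi (repr v)))).
by rewrite !(radquot_mulE, radquot_scaleE) scalerAr.
Qed.

HB.instance Definition _ := GRing.Lmodule_isLalgebra.Build F B radquot_scaleAl.
HB.instance Definition _ := GRing.Lalgebra_isAlgebra.Build F B radquot_scaleAr.

Fact radquot_vect_axiom : Vector.axiom (\dim J^C) B.
Proof.
pose P := daddv_pi J^C J; pose X := vbasis J^C.
have JC0 : (J^C :&: J = 0)%VS by rewrite capvC capv_compl.
have Pdec x : P x + daddv_pi J J^C x = x.
  by apply: daddv_pi_add; rewrite // addvC addv_complf memvf.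
have PB x : x - P x \in J by rewrite -{1}[x]Pdec addrC addKr memv_pi.
have PJ x : x \in J -> P x = 0.
  move=> xJ; apply: (addIr (daddv_pi J J^C x)); rewrite Pdec add0r.
  by rewrite daddv_pi_id ?capv_compl.
have PE x : P (repr (pi x)) = P x.
  apply/esym/eqP; rewrite -subr_eq0 -linearB; apply/eqP/PJ.
  exact: radquot_repr.
exists (fun q : B => \row_i coord X i (P (repr q))).
  move=> a x y; rewrite -{1}[x]reprK -{1}[y]reprK.
  have -> : a *: pi (repr x) + pi (repr y) = pi (a *: repr x + repr y).
    by rewrite -piD -radquot_scaleE.
  by apply/rowP => i; rewrite !mxE !PE !linearP.
exists (fun r : 'rV[F]_(\dim J^C) => pi (\sum_i r 0 i *: X`_i)).
  move=> x; rewrite -[RHS]reprK; apply/eqP; rewrite eq_sym radquot_eq.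
  under eq_bigr do rewrite mxE.
  by rewrite -coord_vbasis ?memv_pi// PB.
move=> r; apply/rowP => i; rewrite mxE PE [P _]daddv_pi_id.
- by rewrite coord_sum_free ?(basis_free (vbasisP _)).
- exact: JC0.
- by apply: rpred_sum => j _; rewrite rpredZ ?vbasis_mem ?memt_nth.
Qed.

HB.instance Definition _ := Lmodule_hasFinDim.Build F B radquot_vect_axiom.
HB.instance Definition _ := Algebra_isFalgebra.Build F B.

Definition radpi (x : A) : B := pi x.

Fact radpi_is_linear : linear radpi.
Proof. by move=> a x y; rewrite /radpi -piD -radquot_scaleE. Qed.
HB.instance Definition _ := GRing.isLinear.Build F A B *:%R radpi radpi_is_linear.

Fact radpi_is_monoid_morphism : monoid_morphism radpi.
Proof. by split=> // x y; rewrite /radpi -radquot_mulE. Qed.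
HB.instance Definition _ :=
  GRing.isMonoidMorphism.Build A B radpi radpi_is_monoid_morphism.

Lemma radpi_surj (q : B) : exists x, radpi x = q.
Proof. by exists (repr q); apply: reprK. Qed.

Lemma radpi_eq0 (x : A) : (radpi x == 0) = (x \in J).
Proof. by rewrite -(linear0 radpi) radquot_eq subr0. Qed.

(* The actions of A / J(A) on J(A), through representatives; lactE and ractE  *)
(* show that they do not depend on the representative when J(A)^2 = 0.        *)
Definition lact (b : B) (w : A) : A := repr b * w.
Definition ract (w : A) (b : B) : A := w * repr b.

Lemma lactE (a w : A) : (J * J = 0)%VS -> w \in J -> lact (radpi a) w = a * w.
Proof.
move=> J2 wJ; apply/esym/eqP; rewrite -subr_eq0 -mulrBl -memv0 -J2.
by rewrite memv_mul ?radquot_repr.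
Qed.

Lemma ractE (a w : A) : (J * J = 0)%VS -> w \in J -> ract w (radpi a) = w * a.
Proof.
move=> J2 wJ; apply/esym/eqP; rewrite -subr_eq0 -mulrBr -memv0 -J2.
by rewrite memv_mul ?radquot_repr.
Qed.

Definition rad_subbimodule (W : {vspace A}) : Prop :=
  (W <= J)%VS /\
  forall (b : B) w, w \in W -> lact b w \in W /\ ract w b \in W.

Definition rad_simple : Prop :=
  forall W : {vspace A}, rad_subbimodule W -> W = 0%VS \/ W = J.

End Radquot.

Section Separable.
Variables (F : fieldType) (B : falgType F).
Local Notation n := (\dim {:B}).
Local Notation e := (vbasis {:B}).

(* B (x) B, with the matrix M standing for \sum_(i, j) M i j e_i (x) e_j.      *)
Definition tensor_square := 'M[F]_n.

Definition tens (x y : B) : tensor_square :=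
  \matrix_(i, j) (coord e i x * coord e j y).

(* The linear map B (x) B -> V induced by a bilinear map beta : B * B -> V    *)
Definition tens_lift (V : lmodType F) (beta : B -> B -> V) (M : tensor_square) : V :=
  \sum_i \sum_j M i j *: beta e`_i e`_j.

Lemma tens_liftE (V : lmodType F) (beta : B -> B -> V) :
  (forall y, linear (beta^~ y)) -> (forall x, linear (beta x)) ->
  forall x y, tens_lift beta (tens x y) = beta x y.
Proof.
move=> betal betar x y.
pose bl y := HB.pack_for {linear B -> V} (beta^~ y)
  (GRing.isLinear.Build F B V *:%R _ (betal y)).
pose br x := HB.pack_for {linear B -> V} (beta x)
  (GRing.isLinear.Build F B V *:%R _ (betar x)).
rewrite -[RHS]/(bl y x) [in RHS](coord_vbasis (memvf x)) linear_sum.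
apply: eq_bigr => i _; rewrite linearZ /= -[beta _ y]/(br _ y).
rewrite [in RHS](coord_vbasis (memvf y)) linear_sum scaler_sumr.
by apply: eq_bigr => j _; rewrite linearZ /= mxE scalerA.
Qed.

Definition tens_mul : tensor_square -> B := tens_lift (fun x y => x * y).

Definition tens_lact (b : B) : tensor_square -> tensor_square :=
  tens_lift (fun x y => tens (b * x) y).

Definition tens_ract (M : tensor_square) (b : B) : tensor_square :=
  tens_lift (fun x y => tens x (y * b)) M.

(* B is separable over F: the multiplication B (x) B -> B splits as a map of  *)
(* B-bimodules (equivalently, B is a projective B-bimodule).                  *)
Definition separable_algebra : Prop :=
  exists sigma : {linear B -> tensor_square},
    [/\ forall x, tens_mul (sigma x) = x,
        forall b x, sigma (b * x) = tens_lact b (sigma x)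
      & forall x b, sigma (x * b) = tens_ract (sigma x) b].

End Separable.

Section Generation.
Variable F : fieldType.
Local Open Scope classical_set_scope.
Local Open Scope card_scope.

Definition generates (A : falgType F) (k : nat) (t : k.-tuple A) : Prop :=
  <<1 & t>>%VS = fullv.

Definition lifts_generators (A B : falgType F) (p : A -> B) (k : nat) : Prop :=
  forall t : k.-tuple B, generates t ->
    exists s : k.-tuple A, map_tuple p s = t /\ generates s.

(* g_k(A, B) = g for the quotient map p : A -> B; this holds for every g when *)
(* B cannot be generated by k elements.                                       *)
Definition is_gk (A B : falgType F) (p : A -> B) (k g : nat) : Prop :=
  forall t : k.-tuple B, generates t ->
    [set s : k.-tuple A | map_tuple p s = t /\ generates s] #= `I_g.

End Generation.

(* Main.v *)
From HB Require Import structures.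
Require Import Defs.
From mathcomp Require Import all_boot all_order all_algebra all_field.
From mathcomp Require Import finmap.
From mathcomp Require Import boolp classical_sets functions cardinality.

Set Implicit Arguments.
Unset Strict Implicit.
Unset Printing Implicit Defensive.

Import GRing.Theory.
Local Open Scope ring_scope.
Local Open Scope quotient_scope.
Local Open Scope classical_set_scope.

(** Write J for J(A), p for the projection A -> B = A/J, and let t generate B.

    A lift u of t generates a subalgebra D with D + J = A.  Since J^2 = 0, J is a
    B-bimodule, so D :&: J is stable under multiplication by D + J = A on either
    side; by simplicity it is 0 or J.  If it is J then D = A.  If it is 0 then p
    maps D isomorphically onto B, so D is the image of a multiplicative section
    of p and u is the image of t under it.  Conversely, when J is nonzero the
    image of a section is a proper subalgebra.  So the lifts of t that do not
    generate A correspond to the algebra sections of p (nongenerating_lift,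
    section_not_generates).

    Separability determines these sections.  If \sum_i x_i (x) y_i is a
    separability idempotent of B, contracting a Hochschild 2-cocycle or 1-cocycle
    with it shows that both kinds of cocycle with values in J are coboundaries.
    In degree 2 this gives a section r (square_zero_splitting); in degree 1 it
    shows that every section is b |-> r b + [r b, w] for some w in J
    (sections_conjugate).  Two elements w, w' give the same section exactly when
    w - w' centralizes r B + J = A, that is, when w - w' lies in C = J :&: Z(A).

    Hence the nongenerating lifts form a translate, inside the translate J^k of
    all lifts, of the image of the linear map w |-> ([r t_i, w])_i from J to J^k,
    whose kernel is C.  This gives |J|^k - |J/C| generating lifts over a finite
    field.  Over any field, some lift generates unless this map is onto.  For
    k >= 2 and J nonzero it is not: if w |-> [r t_0, w] is onto J then it is injective, so the
    other coordinates are determined by the first one.  For A commutative it is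
    the zero map.  If J = 0, every lift generates. *)

(** * The separability idempotent *)

Lemma tens_lift_is_linear (F : fieldType) (B : falgType F) (V : lmodType F)
    (beta : B -> B -> V) : linear (tens_lift beta).
Proof.
move=> a M N; rewrite /tens_lift scaler_sumr -big_split; apply: eq_bigr => i _.
rewrite scaler_sumr -big_split; apply: eq_bigr => j _.
by rewrite !mxE scalerDl scalerA.
Qed.

Lemma linear_tens_lift (F : fieldType) (B : falgType F) (V W : lmodType F)
    (phi : {linear V -> W}) (beta : B -> B -> V) M :
  phi (tens_lift beta M) = tens_lift (fun x y => phi (beta x y)) M.
Proof.
rewrite linear_sum; apply: eq_bigr => i _; rewrite linear_sum.
by apply: eq_bigr => j _; rewrite linearZ.
Qed.

(** The idempotent e is the image of 1 under the bimodule splitting, grouped as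
    \sum_i x_i (x) y_i with the x_i a basis.  The identity b e = e b in B (x) B is stated in the form in
    which it is applied: after contraction with a bilinear map. *)
Lemma separability_idempotent (F : fieldType) (B : falgType F) :
  separable_algebra B ->
  exists n (x y : 'I_n -> B), \sum_i x i * y i = 1 /\
    forall (V : lmodType F) (beta : B -> B -> V),
      (forall v, linear (beta^~ v)) -> (forall u, linear (beta u)) ->
      forall b, \sum_i beta (b * x i) (y i) = \sum_i beta (x i) (y i * b).
Proof.
case=> sigma [sigK sigl sigr]; pose e := vbasis {:B}; pose M := sigma 1.
exists (\dim {:B}), (fun i : 'I__ => e`_i), (fun i : 'I__ => \sum_j M i j *: e`_j).
have liftE (V : lmodType F) (beta : B -> B -> V) : (forall u, linear (beta u)) ->
    tens_lift beta M = \sum_(i < \dim {:B}) beta e`_i (\sum_j M i j *: e`_j).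
  move=> betar; apply: eq_bigr => i _.
  pose br := HB.pack_for {linear B -> V} (beta e`_i)
    (GRing.isLinear.Build F B V *:%R _ (betar e`_i)).
  rewrite -[RHS]/(br _) linear_sum; apply: eq_bigr => j _.
  by rewrite linearZ.
split=> [|V beta betal betar b].
  rewrite -[RHS]sigK /tens_mul liftE// => u a v w.
  by rewrite mulrDr scalerAr.
have betal2 v : linear (fun u => beta (b * u) v).
  by move=> a u w; rewrite mulrDr -scalerAr betal.
have betar2 u : linear (fun v => beta u (v * b)).
  by move=> a v w; rewrite mulrDl -scalerAl betar.
rewrite -(liftE V (fun u v => beta (b * u) v))//.
rewrite -(liftE V (fun u v => beta u (v * b)))//.
pose tl := HB.pack_for {linear tensor_square B -> V} (tens_lift beta)
  (GRing.isLinear.Build F (tensor_square B) V *:%R _ (tens_lift_is_linear beta)).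
have: tl (tens_lact b M) = tl (tens_ract M b).
  by rewrite -sigl -sigr mul1r mulr1.
rewrite /tens_lact /tens_ract !linear_tens_lift /tl /=.
by congr (_ = _); congr tens_lift;
  apply/funext => u; apply/funext => v; rewrite tens_liftE.
Qed.

(** * Generation and counting *)

Lemma generates_sub (F : fieldType) (A : falgType F) k (t : k.-tuple A)
    (E : {subfield A}) : 1 \in E -> {subset t <= E} -> (<<1 & t>> <= E)%VS.
Proof.
move=> E1 tE; apply: agenv_sub_modl; first by rewrite -memvE.
apply: (@subv_trans _ _ (E * E)%VS); last by rewrite prodv_id.
by apply: prodvSl; rewrite subv_add -memvE E1; apply/span_subvP.
Qed.

Lemma mapK_tuple (T U : Type) (f : T -> U) g k (t : k.-tuple T) :
  cancel f g -> map_tuple g (map_tuple f t) = t.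
Proof. by move=> fK; apply/val_inj => /=; rewrite mapK. Qed.

Lemma card_tuples_in (T : choiceType) (S : set T) k : finite_set S ->
  ([set t : k.-tuple T | forall i, S (tnth t i)] #= `I_(#|` fset_set S| ^ k))%card.
Proof.
move=> Sfin; set X := fset_set S.
have -> : [set t : k.-tuple T | forall i, S (tnth t i)] =
    map_tuple (val : X -> T) @` [set` [fset t in {: k.-tuple X}]%fset].
  apply/seteqP; split=> [t /= tS|_ [x _ <-] i]; last first.
    by rewrite tnth_map; have := valP (tnth x i); rewrite in_fset_set// inE.
  have tX i : tnth t i \in X by rewrite in_fset_set// inE; exact: tS.
  exists [tuple FSetSub (tX i) | i < k] => /=; first by rewrite !inE.
  by apply: eq_from_tnth => i; rewrite tnth_map tnth_mktuple.
have inj : {in [set` [fset t in {: k.-tuple X}]%fset] &,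
    injective (map_tuple (val : X -> T) : k.-tuple X -> _)}.
  by move=> x y _ _ /(congr1 val)/= /(inj_map val_inj)/val_inj.
apply: card_eq_trans (inj_card_eq inj) _; apply/card_eq_fsetP.
by rewrite card_finset card_tuple -cardfE.
Qed.

(** Both images are the quotient of S by one and the same equivalence relation. *)
Lemma card_eq_images (T : choiceType) (U V : Type) (f : T -> U) (g : T -> V)
    (S : set T) :
  (forall x y, S x -> S y -> f x = f y <-> g x = g y) ->
  (f @` S #= g @` S)%card.
Proof.
move=> fg.
have [->|/set0P[x0 _]] := eqVneq S set0; first by rewrite !image_set0.
pose h u := g (xget x0 [set x | S x /\ f x = u]).
have hE x : S x -> h (f x) = g x.
  move=> Sx; rewrite /h; case: xgetP => [y _ [Sy fyx]|/(_ x)[]//].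
  exact/fg.
have <- : h @` (f @` S) = g @` S.
  apply/seteqP; split=> [_ [_ [x Sx <-] <-]|_ [x Sx <-]].
    by exists x; rewrite ?hE.
  by exists (f x); [exists x | rewrite hE].
rewrite card_eq_sym; apply: inj_card_eq => u v.
rewrite !inE => -[x Sx <-] [y Sy <-]; rewrite !hE//.
by move=> /fg; apply.
Qed.

Lemma finite_vspace (F : fieldType) (V : vectType F) (U : {vspace V}) :
  finite_set [set: F] -> finite_set [set` U].
Proof.
move=> Ffin; pose X := fset_set [set: F].
pose h (c : {ffun 'I_(\dim {:V}) -> X}) := \sum_i val (c i) *: (vbasis {:V})`_i.
apply: (@sub_finite_set _ _ (h @` [set: {ffun 'I_(\dim {:V}) -> X}])); last first.
  exact/finite_image/finite_finset.
move=> v _; have cX (i : 'I_(\dim {:V})) : coord (vbasis {:V}) i v \in X.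
  by rewrite in_fset_set// inE.
exists [ffun i => FSetSub (cX i)] => //.
rewrite [RHS](coord_vbasis (memvf v)); apply: eq_bigr => i _.
by rewrite ffunE.
Qed.

(** * Square-zero extensions *)

Section SquareZeroExtension.
Variables (F : fieldType) (A B : falgType F) (p : 'AHom(A, B)).
Hypothesis p_surj : limg p = fullv.
Hypothesis ker_sq0 : (lker p * lker p = 0)%VS.
Implicit Types (r s : 'AHom(B, A)) (w : A) (b : B).
Local Notation J := (lker p).

Lemma ker_mul0 u v : u \in J -> v \in J -> u * v = 0.
Proof. by move=> uJ vJ; apply/eqP; rewrite -memv0 -ker_sq0 memv_mul. Qed.

Lemma kerMl a w : w \in J -> a * w \in J.
Proof. by rewrite !memv_ker rmorphM /= => /eqP->; rewrite mulr0. Qed.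

Lemma kerMr a w : w \in J -> w * a \in J.
Proof. by rewrite !memv_ker rmorphM /= => /eqP->; rewrite mul0r. Qed.

Lemma ker_eq a a' : p a = p a' -> a - a' \in J.
Proof. by rewrite memv_ker linearB /= => ->; rewrite subrr. Qed.

(** The products of a with J depend on p a only: this is how J becomes a
    B-bimodule, and b in B acts through any preimage of b. *)
Lemma ker_mul_eql a a' w : p a = p a' -> w \in J -> a * w = a' * w.
Proof.
by move=> paa wJ; apply/eqP; rewrite -subr_eq0 -mulrBl ker_mul0 ?ker_eq.
Qed.

Lemma ker_mul_eqr a a' w : p a = p a' -> w \in J -> w * a = w * a'.
Proof.
by move=> paa wJ; apply/eqP; rewrite -subr_eq0 -mulrBr ker_mul0 ?ker_eq.
Qed.

(** Wedderburn's principal theorem in the square-zero case.  A linear section f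
    fails to be multiplicative by a 2-cocycle c with values in J; contracting c
    with the separability idempotent gives g with coboundary c, and f - g is
    multiplicative. *)
Lemma square_zero_splitting : separable_algebra B -> exists r : 'AHom(B, A), cancel r p.
Proof.
move=> /separability_idempotent[n [x [y [xy1 xyB]]]].
pose f : 'Hom(B, A) := (p^-1)%VF.
have fK b : p (f b) = b by rewrite limg_lfunVK// p_surj memvf.
pose c b d := f b * f d - f (b * d).
have cJ b d : c b d \in J by rewrite ker_eq// rmorphM /= !fK.
have cocycle b d e : c (b * d) e - c b (d * e) + c b d * f e = f b * c d e.
  rewrite /c mulrBr mulrBl !mulrA opprB !addrA subrK.
  by rewrite addrC !addrA addNr add0r addrC.
have fP a u v : f (a *: u + v) = a *: f u + f v by rewrite linearP.
have c_linl d : linear (c^~ d).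
  move=> a u v; rewrite /c mulrDl -scalerAl !fP mulrDl -scalerAl scalerBr.
  by rewrite opprD addrACA.
have c_linr d : linear (c d).
  move=> a u v; rewrite /c mulrDr -scalerAr !fP mulrDr -scalerAr scalerBr.
  by rewrite opprD addrACA.
pose g b := \sum_i f (x i) * c (y i) b.
have gJ b : g b \in J by apply: memv_suml => i _; apply: kerMl.
have gE b d : c b d = f b * g d - g (b * d) + g b * f d.
  (* Multiply the cocycle identity for y_i, b, d by x_i and sum over i. *)
  have <- : \sum_i f (x i) * (f (y i) * c b d) = c b d.
    under eq_bigr do rewrite mulrA.
    rewrite -mulr_suml -[RHS]mul1r; apply: ker_mul_eql => //.
    rewrite rmorph1 linear_sum /= -xy1; apply: eq_bigr => i _.
    by rewrite rmorphM /= !fK.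
  have -> : f b * g d = \sum_i f (x i) * c (y i * b) d.
    rewrite -(xyB _ (fun u v => f u * c v d)).
    - rewrite mulr_sumr; apply: eq_bigr => i _.
      by rewrite mulrA; apply: ker_mul_eql; rewrite // rmorphM /= !fK.
    - by move=> v a u u'; rewrite fP mulrDl scalerAl.
    by move=> u a v v'; rewrite c_linl mulrDr scalerAr.
  rewrite -sumrB mulr_suml -big_split; apply: eq_bigr => i _ /=.
  by rewrite -mulrA -mulrBr -mulrDr cocycle.
have s_lin : linear (fun b => f b - g b).
  move=> a u v; rewrite fP scalerBr addrACA -opprD scaler_sumr -big_split.
  congr (_ - _); apply: eq_bigr => i _ /=.
  by rewrite c_linr mulrDr -scalerAr.
pose s0 := linfun (HB.pack_for {linear B -> A} (fun b => f b - g b)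
    (GRing.isLinear.Build F B A *:%R _ s_lin)).
have s0E b : s0 b = f b - g b by rewrite lfunE.
have s0K b : p (s0 b) = b.
  rewrite s0E linearB /= fK; move: (gJ b).
  by rewrite memv_ker => /eqP->; rewrite subr0.
have s0M b d : s0 (b * d) = s0 b * s0 d.
  rewrite !s0E mulrBl !mulrBr (ker_mul0 (gJ b) (gJ d)) subr0.
  have -> : f (b * d) = f b * f d - c b d by rewrite opprB addrC subrK.
  by rewrite gE -addrA -opprD [_ - _ + _ * _]addrAC subrK opprD addrA.
(* s0 1 is idempotent, so s0 1 - 1 is minus its own square, which is 0. *)
have s01 : s0 1 = 1.
  have eJ : s0 1 - 1 \in J by apply: ker_eq; rewrite s0K rmorph1.
  apply/eqP; rewrite -subr_eq0 -oppr_eq0 -(ker_mul0 eJ eJ) mulrBl !mulrBr.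
  by rewrite -s0M !mulr1 mul1r subrr sub0r.
have s0_ahom : ahom_in {:B} s0 by apply/ahom_inP; split.
by exists (AHom s0_ahom).
Qed.

(** * Sections of the projection *)

(** This is (1 + w)^-1 * r b * (1 + w) when w lies in J, because then
    (1 + w)^-1 = 1 - w and w * r b * w = 0. *)
Definition conj_section r w b := r b + (r b * w - w * r b).

Lemma conj_sectionP r w : cancel r p -> w \in J ->
  exists2 s : 'AHom(B, A), cancel s p & s =1 conj_section r w.
Proof.
move=> rK wJ.
have dJ b : r b * w - w * r b \in J.
  by apply: memvB; [apply: kerMl | apply: kerMr].
pose s0 : 'Hom(B, A) := (ahval r + ((amulr w \o r) - (amull w \o r)))%VF.
have s0E b : s0 b = conj_section r w b.
  by rewrite add_lfunE add_lfunE opp_lfunE !comp_lfunE !lfunE.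
have s0_ahom : ahom_in {:B} s0.
  apply/ahom_inP; split=> [b d _ _|]; last first.
    by rewrite s0E /conj_section rmorph1 mulr1 mul1r subrr addr0.
  rewrite !s0E /conj_section rmorphM /= mulrDl (mulrDr (r b)) (mulrDr (_ - _)).
  rewrite (ker_mul0 (dJ b) (dJ d)).
  by rewrite addr0 mulrBr mulrBl !mulrA !addrA subrK.
exists (AHom s0_ahom) => b /=; last exact: s0E.
rewrite s0E linearD /= rK; move: (dJ b); rewrite memv_ker => /eqP->.
by rewrite addr0.
Qed.

(** Malcev's theorem in the square-zero case: the difference of two sections is a
    derivation B -> J, and contracting it with the separability idempotent shows
    that it is inner. *)
Lemma sections_conjugate r s : separable_algebra B -> cancel r p -> cancel s p ->
  exists2 w, w \in J & s =1 conj_section r w.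
Proof.
move=> /separability_idempotent[n [x [y [xy1 xyB]]]] rK sK.
pose delta b := s b - r b.
have dJ b : delta b \in J by rewrite ker_eq// rK sK.
have dM b d : delta (b * d) = r b * delta d + delta b * r d.
  have -> : delta b * r d = delta b * s d by apply: ker_mul_eqr; rewrite ?rK ?sK.
  by rewrite /delta !rmorphM /= mulrBr mulrBl [RHS]addrC !addrA subrK.
have dP : linear delta.
  by move=> a u v; rewrite /delta !linearP addrACA -scalerDr.
pose w := \sum_i r (x i) * delta (y i).
have wJ : w \in J by apply: memv_suml => i _; apply: kerMl.
exists w => // b; rewrite /conj_section.
suff -> : r b * w - w * r b = delta b by rewrite addrC subrK.
apply/eqP; rewrite subr_eq; apply/eqP.
have -> : r b * w = \sum_i r (x i) * delta (y i * b).
  rewrite -(xyB _ (fun u v => r u * delta v)).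
  - by rewrite mulr_sumr; apply: eq_bigr => i _; rewrite mulrA rmorphM.
  - by move=> v a u u'; rewrite linearP mulrDl /= -scalerAl.
  by move=> u a v v'; rewrite dP mulrDr scalerAr.
under eq_bigr do rewrite dM mulrDr !mulrA.
rewrite big_split -!mulr_suml; congr (_ + _ * _).
rewrite -[RHS]mul1r -(rmorph1 r) -xy1 rmorph_sum; congr (_ * _).
by apply: eq_bigr => i _; rewrite rmorphM.
Qed.

(** * Lifts that do not generate *)

(** A section has proper image: the image meets J in 0 only. *)
Lemma section_not_generates s k (t : k.-tuple B) :
  J != 0%VS -> cancel s p -> ~ generates (map_tuple s t).
Proof.
move=> J0 sK gen; case/negP: J0; rewrite -subv0; apply/subvP => a aJ.
have : a \in limg s.
  have /subvP : (<<1 & map_tuple s t>> <= limg s)%VS.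
    by rewrite -(aimg1 s) -aimg_adjoin_seq limgS ?subvf.
  by apply; rewrite gen memvf.
case/memv_imgP => b _ ab; move: aJ; rewrite memv_ker ab sK => /eqP->.
by rewrite linear0 memv0.
Qed.

(** Modulo J, the elements of A are represented in the subalgebra generated by a
    lift: its image contains t, hence is B. *)
Lemma lift_spans_mod_ker k (t : k.-tuple B) (u : k.-tuple A) :
  generates t -> map_tuple p u = t ->
  forall a, exists2 d, d \in <<1 & u>>%VS & p a = p d.
Proof.
move=> gent put a.
suff : p a \in (p @: <<1 & u>>)%VS by case/memv_imgP => d dD ->; exists d.
rewrite aimg_adjoin_seq aimg1.
have -> : [seq p i | i <- u] = t by rewrite -put.
by rewrite gent memvf.
Qed.

Lemma lift_generates_ker k (t : k.-tuple B) (u : k.-tuple A) :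
  generates t -> map_tuple p u = t -> (J <= <<1 & u>>)%VS -> generates u.
Proof.
move=> gent put /subvP JD; apply/eqP; rewrite eqEsubv subvf.
apply/subvP => a _; have [d dD pa] := lift_spans_mod_ker gent put a.
by rewrite -(subrK d a) memvD// JD// ker_eq.
Qed.

(** Simplicity of J as a bimodule, expressed with the actions of A. *)
Definition ker_minimal : Prop := forall W : {vspace A}, (W <= J)%VS ->
  (forall a w, w \in W -> a * w \in W /\ w * a \in W) -> W = 0%VS \/ W = J.

(** The subalgebra D generated by u meets J in a sub-bimodule other than J, hence
    in 0; so D is a complement of J, and inverting the isomorphism from D to B
    gives the section. *)
Lemma nongenerating_lift k (t : k.-tuple B) (u : k.-tuple A) :
  ker_minimal -> generates t -> map_tuple p u = t -> ~ generates u ->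
  exists2 s : 'AHom(B, A), cancel s p & u = map_tuple s t.
Proof.
move=> Jsimple gent put ngenu; pose D := <<1 & u>>%AS.
have pD := lift_spans_mod_ker gent put.
have [DJ|DJ] : (D :&: J = 0)%VS \/ (D :&: J = J)%VS.
- apply: Jsimple => [|a w]; first exact: capvSr.
  rewrite !memv_cap => /andP[wD wJ]; have [d dD pa] := pD a.
  rewrite (ker_mul_eql pa wJ) (ker_mul_eqr pa wJ) (kerMl d wJ) (kerMr d wJ).
  by rewrite !andbT !memvM.
- have DJ0 a : a \in D -> p a = 0 -> a = 0.
    move=> aD pa; apply/eqP; rewrite -memv0 -DJ memv_cap aD memv_ker pa.
    exact: eqxx.
  have DeqJ a a' : a \in D -> a' \in D -> p a = p a' -> a = a'.
    move=> aD a'D paa; apply/eqP; rewrite -subr_eq0; apply/eqP/DJ0.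
      exact: memvB.
    by rewrite linearB /= paa subrr.
  (* Lift linearly, then project to D along J: linearity comes for free. *)
  pose s0 : 'Hom(B, A) := (daddv_pi D J \o p^-1)%VF.
  have s0D b : s0 b \in D by rewrite comp_lfunE memv_pi.
  have s0K b : p (s0 b) = b.
    rewrite comp_lfunE; set a := (p^-1)%VF b.
    have <- : p a = b by rewrite limg_lfunVK// p_surj memvf.
    have aE : daddv_pi D J a + daddv_pi J D a = a.
      apply: daddv_pi_add => //; have [d dD pa] := pD a.
      by rewrite -(subrK d a) addrC memv_add// ker_eq.
    rewrite -[in RHS]aE linearD /=.
    by have := memv_pi J D a; rewrite memv_ker => /eqP->; rewrite addr0.
  have s0_ahom : ahom_in {:B} s0.
    apply/ahom_inP; split=> [b d _ _|]; apply: DeqJ; rewrite ?s0D ?s0K//.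
    - by rewrite memvM ?s0D.
    - by rewrite rmorphM /= !s0K.
    - by apply: (subvP (sub1_agenv _)); rewrite memv_line.
    - by rewrite rmorph1.
  exists (AHom s0_ahom) => //; apply: eq_from_tnth => i; rewrite tnth_map.
  apply: DeqJ => //=; first by rewrite seqv_sub_adjoin ?mem_tnth.
  by rewrite s0K -put tnth_map.
by case: ngenu; apply: lift_generates_ker gent put _; rewrite -DJ capvSl.
Qed.

Section NonzeroKernel.
Hypothesis sepB : separable_algebra B.
Hypothesis ker_min : ker_minimal.
Hypothesis ker_neq0 : J != 0%VS.

Lemma nongenerating_liftP r k (t : k.-tuple B) (u : k.-tuple A) :
  cancel r p -> generates t ->
  (map_tuple p u = t /\ ~ generates u) <->
  exists2 w, w \in J & u = map_tuple (conj_section r w) t.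
Proof.
move=> rK gent; split=> [[put ngenu]|[w wJ ->]].
  have [s sK ->] := nongenerating_lift ker_min gent put ngenu.
  have [w wJ sE] := sections_conjugate sepB rK sK; exists w => //.
  by apply/val_inj/eq_map.
have [s sK sE] := conj_sectionP rK wJ.
have -> : map_tuple (conj_section r w) t = map_tuple s t.
  by apply/val_inj => /=; apply/esym/eq_map.
by split; [exact: mapK_tuple | exact: section_not_generates].
Qed.

(** Equality on t says that w - w' commutes with the r t_i, hence with the algebra
    r B that they generate; it commutes with J because J^2 = 0, and
    A = r B + J. *)
Lemma conj_section_eqP r k (t : k.-tuple B) w w' : cancel r p -> generates t ->
  w \in J -> w' \in J ->
  map_tuple (conj_section r w) t = map_tuple (conj_section r w') t <->
  w - w' \in (J :&: 'Z({:A}))%VS.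
Proof.
move=> rK gent wJ w'J.
have ->: (w - w' \in (J :&: 'Z({:A}))%VS) = (w - w' \in 'C({:A}))%VS.
  by rewrite memv_cap memvB// memv_cap memvf.
have conjE b : (conj_section r w b == conj_section r w' b) =
    (r b * (w - w') == (w - w') * r b).
  rewrite /conj_section (inj_eq (addrI _)) mulrBr mulrBl.
  by rewrite -subr_eq0 -[RHS]subr_eq0 !opprD addrACA.
split=> [/(congr1 val)/= e|/centvP cw].
  have rC : (limg r <= 'C[w - w'])%VS.
    rewrite -gent aimg_adjoin_seq aimg1.
    apply: (@generates_sub _ _ _ (map_tuple r t) 'C[w - w']%AS);
      first exact: cent1v1.
    move=> _ /mapP[b bt ->]; apply/cent1vP/eqP; rewrite -conjE.
    by apply/eqP; move/eq_in_map: e; apply.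
  apply/centvP => a _; have rpa : p a = p (r (p a)) by rewrite rK.
  rewrite (ker_mul_eqr rpa) ?(ker_mul_eql rpa) ?memvB//.
  by apply/esym/cent1vP/(subvP rC)/memv_img/memvf.
apply/val_inj => /=; apply/eq_map => b; apply/eqP.
by rewrite conjE cw ?memvf.
Qed.

(** The lifts of t are r t + j with j in J^k, and such a lift fails to generate
    only when j is a tuple of commutators [r t_i, w]. *)
Lemma nongenerating_commutators r k (t : k.-tuple B) : cancel r p -> generates t ->
  (forall u : k.-tuple A, map_tuple p u = t -> ~ generates u) ->
  forall j : 'I_k -> A, (forall i, j i \in J) -> exists2 w, w \in J &
    forall i, r (tnth t i) * w - w * r (tnth t i) = j i.
Proof.
move=> rK gent ngen j jJ; pose u := [tuple r (tnth t i) + j i | i < k].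
have put : map_tuple p u = t.
  apply: eq_from_tnth => i; rewrite tnth_map tnth_mktuple linearD /= rK.
  by move: (jJ i); rewrite memv_ker => /eqP->; rewrite addr0.
have [w wJ uE] := (nongenerating_liftP u rK gent).1 (conj put (ngen u put)).
exists w => // i; have := congr1 (fun v => tnth v i) uE.
by rewrite /u tnth_mktuple tnth_map => /addrI.
Qed.

End NonzeroKernel.

(** * Existence and number of generating lifts *)

Lemma lift_exists k (t : k.-tuple B) : exists u : k.-tuple A, map_tuple p u = t.
Proof.
exists (map_tuple (p^-1)%VF t); apply: mapK_tuple => b.
by rewrite limg_lfunVK// p_surj memvf.
Qed.

(** If J = 0 every lift generates; otherwise a tuple j in J^k that consists of no
    common commutators yields the generating lift r t + j. *)
Lemma lifts_generators_criterion k : separable_algebra B -> ker_minimal ->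
  (J != 0%VS -> forall r (b : 'I_k -> B), exists2 j : 'I_k -> A,
    (forall i, j i \in J) & forall w, w \in J ->
      ~ forall i, r (b i) * w - w * r (b i) = j i) ->
  lifts_generators p k.
Proof.
move=> sepB ker_min not_onto t gent; have [J0|J0] := eqVneq J 0%VS.
  have [u put] := lift_exists t; exists u; split=> //.
  by apply: lift_generates_ker gent put _; rewrite J0 sub0v.
apply: contrapT => nex; have [r rK] := square_zero_splitting sepB.
have [j jJ ncj] := not_onto J0 r (tnth t).
have [|w wJ /(ncj w wJ)//] :=
  nongenerating_commutators sepB ker_min J0 rK gent _ jJ.
by move=> u put genu; apply: nex; exists u.
Qed.

(** Either w |-> [r b_0, w] misses some y in J, and then j may start with y; or it
    is onto J, hence injective by dimension, and then j_0 = 0 forces w = 0, which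
    excludes j_i = x != 0 for the other i. *)
Lemma lifts_generators_ge2 k : separable_algebra B -> ker_minimal ->
  (2 <= k)%N -> lifts_generators p k.
Proof.
case: k => [|[|k]]// sepB ker_min _; apply: lifts_generators_criterion => // J0 r b.
pose comm b : 'End(A) := (amull (r b) - amulr (r b))%VF.
have commE c w : comm c w = r c * w - w * r c.
  by rewrite add_lfunE opp_lfunE !lfunE.
have [x xJ x0] : exists2 x, x \in J & x != 0.
  by exists (vpick J); rewrite ?memv_pick ?vpick0.
have [surj|] := boolP (J <= comm (b ord0) @: J)%VS; last first.
  case/subvPn => y yJ yn; exists (fun i => if i == ord0 then y else 0).
    by move=> i; case: ifP => // _; exact: mem0v.
  move=> w wJ /(_ ord0); rewrite eqxx -commE => yE; case/negP: yn.
  by rewrite -yE memv_img.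
exists (fun i => if i == ord0 then 0 else x).
  by move=> i; case: ifP => // _; exact: mem0v.
move=> w wJ cw; case/negP: x0.
suff w0 : w = 0 by have /= <- := cw ord_max; rewrite w0 mulr0 mul0r subrr.
apply/eqP; rewrite -memv0.
have <- : (J :&: lker (comm (b ord0)))%VS = 0%VS.
  apply/eqP; rewrite -dimv_eq0 -leqn0 -(leq_add2r (\dim (comm (b ord0) @: J))).
  by rewrite limg_ker_dim add0n dimvS.
by rewrite memv_cap wJ memv_ker commE cw !eqxx.
Qed.

(** All commutators vanish, so any nonzero constant tuple j will do. *)
Lemma lifts_generators_comm k : (0 < k)%N -> separable_algebra B -> ker_minimal ->
  (forall a a' : A, a * a' = a' * a) -> lifts_generators p k.
Proof.
case: k => // k _ sepB ker_min comm.
apply: lifts_generators_criterion => // J0 r b.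
exists (fun=> vpick J) => [_|w wJ /(_ ord0)]; first exact: memv_pick.
by rewrite comm subrr => /esym/eqP; rewrite vpick0 (negPf J0).
Qed.

(** All lifts form a translate of J^k; those that do not generate are the image of J
    under w |-> conj_section r w t, whose fibres are the cosets of C.  The map q
    stands for any realization of the quotient by C. *)
Lemma gk_square_zero (Q : choiceType) (q : A -> Q) k :
  separable_algebra B -> ker_minimal -> J != 0%VS -> finite_set [set` J] ->
  (forall x y, q x = q y <-> x - y \in (J :&: 'Z({:A}))%VS) ->
  is_gk p k (#|` fset_set [set` J]| ^ k - #|` fset_set (q @` [set` J])|)%N.
Proof.
move=> sepB ker_min J0 Jfin qE t gent; have [r rK] := square_zero_splitting sepB.
set lifts := [set u : k.-tuple A | map_tuple p u = t].
pose bad := (fun w => map_tuple (conj_section r w) t) @` [set` J].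
have lifts_card : (lifts #= `I_(#|` fset_set [set` J]| ^ k))%card.
  pose tr (j : k.-tuple A) := [tuple r (tnth t i) + tnth j i | i < k].
  have -> : lifts = tr @` [set j | forall i, [set` J] (tnth j i)].
    apply/seteqP; split=> [u /= put|_ [j jJ <-]] /=.
      exists [tuple tnth u i - r (tnth t i) | i < k] => /= [i|].
        by rewrite tnth_mktuple ker_eq// rK -put tnth_map.
      by apply: eq_from_tnth => i; rewrite !tnth_mktuple addrC subrK.
    apply: eq_from_tnth => i; rewrite tnth_map tnth_mktuple linearD /= rK.
    by move: (jJ i) => /=; rewrite memv_ker => /eqP->; rewrite addr0.
  apply: card_eq_trans (card_tuples_in k Jfin).
  apply: inj_card_eq => j j' _ _ e; apply: eq_from_tnth => i.
  by have := congr1 (fun v => tnth v i) e; rewrite !tnth_mktuple => /addrI.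
have badE u : bad u <-> lifts u /\ ~ generates u.
  rewrite (nongenerating_liftP sepB ker_min J0 u rK gent).
  by split=> [[w wJ <-]|[w wJ ->]]; exists w.
have -> : [set u : k.-tuple A | map_tuple p u = t /\ generates u] = lifts `\` bad.
  apply/seteqP; split=> u /= [put ngen]; split=> //; first by case/badE.
  by apply: contrapT => genu; apply: ngen; apply/badE.
have bad_card : (bad #= q @` [set` J])%card.
  apply: card_eq_images => w w' wJ w'J.
  by rewrite (conj_section_eqP rK gent wJ w'J) qE.
have lifts_fin : finite_set lifts.
  by apply/finite_setP; exists (#|` fset_set [set` J]| ^ k)%N.
have bad_fin : finite_set bad by apply: finite_image.
have -> : #|` fset_set (q @` [set` J])| = #|` fset_set bad|.
  by apply/esym/fcard_eq => //; apply: finite_image.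
rewrite -(card_fset_set lifts_card) -cardfsDS; last first.
  apply/fsubsetP => u; rewrite !in_fset_set// !inE.
  by move=> /badE[].
rewrite -fset_setD// -[X in (X #= _)%card]fset_setK; last exact: finite_setD.
exact/card_eq_fsetP.
Qed.

End SquareZeroExtension.

Theorem theorem2p7 (F : fieldType) (A : falgType F)
    (J2 : (jacobson A * jacobson A = 0)%VS)
    (Jsimple : rad_simple A)
    (sepB : separable_algebra (radquot A)) :
  [/\ forall k : nat, (2 <= k)%N -> lifts_generators (@radpi F A) k,
      (forall x y : A, x * y = y * x) -> lifts_generators (@radpi F A) 1
    & finite_set [set: F] -> jacobson A <> 0%VS ->
      let C := (jacobson A :&: 'Z({:A}))%VS in
      forall k : nat, (0 < k)%N ->
        is_gk (@radpi F A) k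
          (#|` fset_set [set` jacobson A]| ^ k
           - #|` fset_set
                 [set \pi_{ideal_quot (pred_of_vspace C)} x | x in [set` jacobson A]]|)%N].
Proof.
pose p : 'AHom(A, radquot A) := linfun_ahom (@radpi F A).
have pE : p =1 @radpi F A by move=> x; rewrite lfunE.
have pfE : (p : A -> radquot A) = @radpi F A by apply/funext.
have kerp : lker p = jacobson A.
  by apply/vspaceP => x; rewrite memv_ker pE radpi_eq0.
have p_surj : limg p = fullv.
  apply/eqP; rewrite eqEsubv subvf; apply/subvP => b _.
  have [a <-] := radpi_surj b; apply/memv_imgP.
  by exists a; rewrite ?memvf ?pE.
have ker_sq0 : (lker p * lker p = 0)%VS by rewrite kerp.
have ker_min : ker_minimal p.
  rewrite /ker_minimal kerp => W WJ Wstable; apply: Jsimple; split=> // b w wW.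
  by have [] := Wstable (repr b) w wW.
rewrite -pfE; split=> [k k2|comm|Ffin J0 C k _].
- exact: lifts_generators_ge2.
- exact: lifts_generators_comm.
rewrite -kerp; apply: gk_square_zero => //.
- by rewrite kerp; apply/eqP.
- exact: finite_vspace.
move=> x y; rewrite kerp -/C; split=> [/eqP|xyC].
  by rewrite -Quotient.idealrBE.
by apply/eqP; rewrite -Quotient.idealrBE.
Qed.
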